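(* For every integer $k \geq 1$, let $G_k = \{0,1,2\}^k \subset \mathbb{R}^k$ and let $h(k)$ be the minimum number of line segments of a polygonal chain in $\mathbb{R}^k$ that visits every point of $G_k$ at least once and is contained in some axis-aligned hypercube of side length $3$ containing $G_k$. Then, for every integer $k \geq 1$, $$h(k) = \frac{3^k-1}{2}.$$ In particular, for every integer $k \geq 1$ there exists a polygonal chain with exactly $\frac{3^k-1}{2}$ line segments that visits all $3^k$ points of $G_k$ and stays inside an axis-aligned $3 \times 3 \times \cdots \times 3$ box (a hypercube of side length $3$, hence of volume $3^k$) containing $G_k$, and $h(k+1) = 3\,h(k)+1 = \frac{3^{k+1}-1}{2}$.
   Context: A polygonal chain with $m$ line segments is a connected sequence of $m$ straight line segments $[p_0,p_1],[p_1,p_2],\dots,[p_{m-1},p_m]$ in $\mathbb{R}^k$, in which consecutive segments share an endpoint. The turning points $p_i$ may be any points of $\mathbb{R}^k$ (points of $G_k$ or Steiner points not in $G_k$), the chain may cross itself, and points of $G_k$ may be visited more than once. The chain visits a point if the point lies on at least one of its segments. *)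

(* Defs.v *)
From mathcomp Require Import all_boot all_order all_algebra.
From mathcomp Require Import all_classical all_reals.

Set Implicit Arguments.
Unset Strict Implicit.
Unset Printing Implicit Defensive.

Import Order.TTheory GRing.Theory Num.Theory.

Local Open Scope classical_set_scope.
Local Open Scope ring_scope.

Definition segment (R : realType) (k : nat) (a b : 'rV[R]_k) : set 'rV[R]_k :=
  [set (1 - t) *: a + t *: b | t in `[0, 1]].

(* The union of the [m] segments [p 0, p 1], ..., [p (m-1), p m]; the values
   of [p] beyond [m] are irrelevant.  The turning points are arbitrary, so
   consecutive ones may coincide; as dropping a zero-length segment leaves
   the rest of a covering chain covering, this does not affect the minimum
   below (which, for k > 0, is never reached with a zero-length segment). *)
Definition chain (R : realType) (k m : nat) (p : nat -> 'rV[R]_k) :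
    set 'rV[R]_k :=
  \bigcup_(i in `I_m) segment (p i) (p i.+1).

Definition grid (R : realType) (k : nat) : set 'rV[R]_k :=
  [set x | forall i : 'I_k, x 0 i \in [:: 0; 1; 2]].
Arguments grid : clear implicits.

Definition box (R : realType) (k : nat) (lo hi : 'rV[R]_k) : set 'rV[R]_k :=
  [set x | forall i : 'I_k, lo 0 i <= x 0 i <= hi 0 i].

(* The volume of [box lo hi] when [lo] is coordinatewise below [hi]. *)
Definition box_volume (R : realType) (k : nat) (lo hi : 'rV[R]_k) : R :=
  \prod_(i < k) (hi 0 i - lo 0 i).

Definition is_hypercube (R : realType) (k : nat) (s : R) (lo hi : 'rV[R]_k) :
    Prop :=
  forall i : 'I_k, hi 0 i - lo 0 i = s.

Definition admissible_length (R : realType) (k : nat) : set nat :=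
  [set m | exists p : nat -> 'rV[R]_k,
     grid R k `<=` chain m p /\
     exists lo hi : 'rV[R]_k,
       [/\ is_hypercube 3 lo hi, grid R k `<=` box lo hi &
           chain m p `<=` box lo hi]].

Definition minimums (A : set nat) : set nat :=
  [set m | A m /\ forall n, A n -> (m <= n)%N].

(* A set of naturals has at most one minimum; the default value 0 is only
   taken when there is none. *)
Definition h (R : realType) (k : nat) : nat :=
  xget 0%N (minimums (admissible_length R k)).

(* Main.v *)
Require Import Defs.
From mathcomp Require Import all_boot all_order all_algebra.
From mathcomp Require Import all_classical all_reals.
From mathcomp Require Import zify ring lra.

Import Order.TTheory GRing.Theory Num.Theory.

Local Open Scope classical_set_scope.
Local Open Scope ring_scope.

(** Upper bound.  Put a subset A of the k coordinates at the point 3 * 1_A.  The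
    segment between two disjoint sets A and B visits 2 * 1_A + 1_B and
    1_A + 2 * 1_B, so every nonzero point of the grid lies on the segment of
    exactly one unordered disjoint pair {A, B}.  The disjointness graph on
    subsets has (3^k - 1) / 2 edges, and all its degrees are even except those
    of the empty and the full set; an Euler trail between these two is the
    chain.

    Lower bound.  A segment visits at most 3 grid points, so it is enough that
    between two segments with 3 new points there is one with at most 1.  Let a
    segment visit 3 new points, ending with c, and follow the chain backwards
    through segments with 2 new points each.  Because of the box, every turning
    point met has to lie exactly one unit beyond the grid, and it is obtained
    from c by replacing some entries 0 by 3 and 2 by -1.  A segment with 3 new
    points at such a turning point would contain c. *)

(** * Upper bound: an Euler trail through the disjoint pairs of subsets *)

Fixpoint trail_length (k : nat) : nat :=
  if k is k'.+1 then (3 * trail_length k' + 1)%N else 0%N.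

(* [trail_index] and [trail_bit] give, at step [j] of the trail for [k.+1], the
   position on the trail for [k] (of length [n]) and the new coordinate. *)
Definition trail_index (n j : nat) : nat :=
  if (j <= n)%N then j
  else if (j <= 2 * n)%N then (2 * n - j)%N else (j - (2 * n).+1)%N.

Definition trail_bit (n j : nat) : bool :=
  if (j <= n)%N then false
  else if (j <= 2 * n)%N then odd (j - n) else ~~ odd (3 * n + 1 - j).

(* The recursion behind 3 n + 1: follow the old trail to the full set, come back
   along it adding the new coordinate to every second set, cross the edge
   between the empty set and the new singleton, and return along the old trail
   with the new coordinate in the complementary positions. *)
Fixpoint trail (k j i : nat) : bool :=
  if k is k'.+1 then
    if i == k' then trail_bit (trail_length k') j
    else trail k' (trail_index (trail_length k') j) i
  else false.

Lemma trail_lengthE (k : nat) : trail_length k = ((3 ^ k - 1) %/ 2)%N.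
Proof.
suff: (3 ^ k = 2 * trail_length k + 1)%N by lia.
by elim: k => //= k IH; rewrite expnS; lia.
Qed.

Lemma trail_start (k i : nat) : trail k 0 i = false.
Proof. by elim: k => //= k IH; case: eqP. Qed.

(** Induction on [k]. The new trail runs along each old edge three times: without the new
    coordinate, then backwards and again forwards with the new coordinate at one end of the edge, at
    opposite ends in these two passes. This yields the values 0, [t] and [3 - t] at coordinate [k],
    hence all three. Points supported on [k] alone lie on the edge crossed between the second and
    the third pass. *)
Lemma trail_cover_nonzero (k : nat) (v : nat -> nat) :
    (forall i, (i < k)%N -> (v i < 3)%N) ->
    (exists2 i, (i < k)%N & v i != 0%N) ->
  exists j t, [/\ (j < trail_length k)%N, (0 < t < 3)%N &
    forall i, (i < k)%N -> v i = ((3 - t) * trail k j i + t * trail k j.+1 i)%N].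
Proof.
elim: k => [_ [] //|k IH] vlt [i0 i0k vi0] /=.
set n := trail_length k.
have vk := vlt k (ltnSn k).
have [[i1 i1k vi1]|v0] := pselect (exists2 i, (i < k)%N & v i != 0%N).
  have [|j [t [jn t3 vE]]] := IH _ (ex_intro2 _ _ i1 i1k vi1).
    by move=> i ik; apply: vlt; lia.
  (* Step [j'] of the new trail projects to the old edge [j], either in the same direction or
     reversed; reversal turns [t] into [3 - t]. *)
  pose lifted := exists j' t', [/\ (j' < 3 * n + 1)%N, (0 < t' < 3)%N,
      v k = ((3 - t') * trail_bit n j' + t' * trail_bit n j'.+1)%N &
      (trail_index n j' = j /\ trail_index n j'.+1 = j.+1 /\ t' = t) \/
      (trail_index n j' = j.+1 /\ trail_index n j'.+1 = j /\ t' = 3 - t)%N].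
  suff main : lifted.
    have [j' [t' [j'n t'3 vkE ix]]] := main.
    exists j', t'; split=> // i; rewrite ltnS leq_eqVlt => /orP[/eqP->|ik].
      by rewrite eqxx.
    rewrite (ltn_eqF ik) vE //.
    by case: ix => [[-> [-> ->]]//|[-> [-> ->]]]; lia.
  have [vk0|vkn0] := eqVneq (v k) 0%N.
    exists j, t; rewrite /trail_bit /trail_index.
    by rewrite jn (ltnW jn); split=> //; [lia|rewrite vk0; lia|left].
  (* The third pass takes edge [j] at step [2 * n + 1 + j], the second at step [2 * n - j.+1]. The
     parity of [n - j] decides which end carries the new coordinate. *)
  have fwd : v k = ((3 - t) * ~~ odd (n - j) + t * odd (n - j))%N -> lifted.
    move=> vkE; exists (2 * n + 1 + j)%N, t; rewrite /trail_bit /trail_index.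
    have -> : (2 * n + 1 + j <= n)%N = false by lia.
    have -> : (2 * n + 1 + j <= 2 * n)%N = false by lia.
    have -> : (2 * n + 1 + j < n)%N = false by lia.
    have -> : (2 * n + 1 + j < 2 * n)%N = false by lia.
    split=> //; [lia| |left; split; lia].
    have -> : (3 * n + 1 - (2 * n + 1 + j))%N = (n - j)%N by lia.
    have -> : (3 * n + 1 - (2 * n + 1 + j).+1)%N = (n - j.+1)%N by lia.
    by rewrite vkE (_ : (n - j)%N = (n - j.+1).+1) /= ?negbK //; lia.
  have bwd : v k = ((3 - t) * odd (n - j) + t * ~~ odd (n - j))%N -> lifted.
    move=> vkE; exists (2 * n - j.+1)%N, (3 - t)%N.
    rewrite /trail_bit /trail_index.
    have -> : ((2 * n - j.+1).+1 <= n)%N = false by lia.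
    have -> : ((2 * n - j.+1) <= 2 * n)%N by lia.
    have -> : ((2 * n - j.+1) < 2 * n)%N by lia.
    split; [lia|lia| |right; split; [by case: ifP; lia|split; lia]].
    have -> : (if (2 * n - j.+1 <= n)%N then false else odd (2 * n - j.+1 - n))
            = odd (n - j.+1).
      case: ifP => // le; last by congr odd; lia.
      by rewrite (_ : (n - j.+1)%N = 0%N) //; lia.
    have -> : ((2 * n - j.+1).+1 - n = n - j)%N by lia.
    rewrite vkE (_ : (n - j)%N = (n - j.+1).+1) /=; last lia.
    by case: odd => /=; lia.
  have [vkt|vkt] : v k = t \/ v k = (3 - t)%N by lia.
    by case: (odd (n - j)) fwd bwd => fwd bwd; [apply: fwd|apply: bwd];
      rewrite vkt /=; lia.
  by case: (odd (n - j)) fwd bwd => fwd bwd; [apply: bwd|apply: fwd];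
    rewrite vkt /=; lia.
have {}v0 i : (i < k)%N -> v i = 0%N.
  by move=> ik; apply/eqP; apply: contra_notT v0 => ?; exists i.
have vk0 : v k != 0%N.
  move: i0k vi0; rewrite ltnS leq_eqVlt => /orP[/eqP->//|/v0->//].
have ix : trail_index n (2 * n) = 0%N /\ trail_index n (2 * n).+1 = 0%N.
  by rewrite /trail_index; split; repeat case: ifP; lia.
have b0 : trail_bit n (2 * n) = odd n.
  rewrite /trail_bit; case: ifP => [le|_]; first by rewrite (_ : n = 0%N) //; lia.
  by rewrite leqnn; congr odd; lia.
have b1 : trail_bit n (2 * n).+1 = ~~ odd n.
  rewrite /trail_bit ifF; last lia.
  by rewrite ifF; [congr (~~ odd _); lia|lia].
(* Step [2 * n] joins the empty set and the new singleton, starting from the singleton exactly when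
   [n] is odd. *)
exists (2 * n)%N, (if odd n then 3 - v k else v k)%N; split; first lia.
  by case: odd; lia.
move=> i; rewrite ltnS leq_eqVlt => /orP[/eqP->|ik].
  by rewrite eqxx b0 b1; case: odd; lia.
by rewrite (ltn_eqF ik) ix.1 ix.2 !trail_start v0 //; lia.
Qed.

(** Allowing [t = 0] adds the origin, where the trail starts; [0 < k] ensures that there is a step
    0. *)
Lemma trail_cover (k : nat) (v : nat -> nat) :
    (0 < k)%N -> (forall i, (i < k)%N -> (v i < 3)%N) ->
  exists j t, [/\ (j < trail_length k)%N, (t <= 3)%N &
    forall i, (i < k)%N -> v i = ((3 - t) * trail k j i + t * trail k j.+1 i)%N].
Proof.
move=> k0 vlt.
have [/(trail_cover_nonzero _ _ vlt) [j [t [? ? ?]]]|v0] :=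
  pselect (exists2 i, (i < k)%N & v i != 0%N).
  by exists j, t; split=> //; lia.
exists 0%N, 0%N; split=> // [|i ik].
  by case: k k0 {vlt v0} => //= k _; rewrite addn1.
by rewrite trail_start; apply/eqP; apply: contra_notT v0 => vi; exists i.
Qed.

(** * Segments through points of the grid *)

Section Grid.
#[local] Set Implicit Arguments.
#[local] Unset Strict Implicit.
Variables (R : realType) (k : nat).
Implicit Types (x y a b c d : 'rV[R]_k) (r s t : R).

(** The parameter is measured from the second endpoint, because segments are mostly read backwards
    from the turning point where they end. *)
Lemma segmentP a b y :
  segment a b y <->
  exists2 t : R, 0 <= t <= 1 & forall i, y 0 i = b 0 i + t * (a 0 i - b 0 i).
Proof.
split=> [[t]|[t t01 yE]].
  rewrite /= in_itv /= => /andP[t0 t1] <-; exists (1 - t); first lra.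
  by move=> i; rewrite !mxE; ring.
exists (1 - t) => /=; first by rewrite in_itv /=; lra.
by apply/rowP => i; rewrite !mxE yE; ring.
Qed.

Lemma segmentC a b : segment a b = segment b a.
Proof.
by apply/seteqP; split=> y [t /= t01 <-]; exists (1 - t) => /=;
  rewrite ?in_itv /= ?subKr 1?addrC //; move: t01; rewrite in_itv /=; lra.
Qed.

Lemma gridP y : grid R k y <-> forall i, [\/ y 0 i = 0, y 0 i = 1 | y 0 i = 2].
Proof.
split=> gy i; have := gy i; rewrite !inE; last by case=> ->; rewrite eqxx ?orbT.
by case/or3P => /eqP ?; [constructor 1|constructor 2|constructor 3].
Qed.

(* In each case [al / be] is determined by [rho], differs from 1/2, and tells
   [x] from [x + d]. *)
Lemma moving_coordinate (x d h h' v al be rho : R) :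
    [\/ x = 0, x = 1 | x = 2] -> [\/ x + d = 0, x + d = 1 | x + d = 2] ->
    [\/ h = 0, h = 1 | h = 2] -> [\/ h' = 0, h' = 1 | h' = 2] ->
    d = 1 \/ d = -1 -> 0 < rho < 1 -> 0 <= al < be ->
    h = x - rho * d + al * v -> h' = x - rho * d + be * v ->
  (h = x /\ (al * (1 + rho) = be * rho \/ al * (2 + rho) = be * rho)) \/
  (h = x + d /\ al * (2 + rho) = be * (1 + rho)).
Proof.
move=> gx gxd gh gh' dE /andP[r0 r1] /andP[al0 albe] hE h'E.
have E : be * (h - x + rho * d) = al * (h' - x + rho * d).
  by rewrite hE h'E; ring.
clear hE h'E; case: dE E gxd => ->; case: gx => ->; case: gh => ->;
  case: gh' => -> E; case => ?;
first [exfalso; nra | left; split; [lra|left; lra] |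
    left; split; [lra|right; lra] | right; split; [lra|lra]].
Qed.

(** If [h] differs from [x], then [h - x] and [h' - x] have the same sign and the second is larger
    in absolute value, so they are 1 and 2 up to sign. *)
Lemma fixed_coordinate (x h h' v al be : R) :
    [\/ x = 0, x = 1 | x = 2] ->
    [\/ h = 0, h = 1 | h = 2] -> [\/ h' = 0, h' = 1 | h' = 2] ->
    0 < al < be -> h = x + al * v -> h' = x + be * v ->
  h = x \/ 2 * al = be.
Proof.
move=> gx gh gh' /andP[al0 albe] hE h'E.
have E : be * (h - x) = al * (h' - x) by rewrite hE h'E; ring.
by case: gx E => ->; case: gh => ->; case: gh' => -> E;
  first [by left | right; lra | exfalso; nra].
Qed.

(** Let [h] be nearer to [q] than [h']. In each coordinate where [d] moves, the ratio [al / be] is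
    below 1/2 if [h] agrees with [x] and above 1/2 if it agrees with [x + d]. As the ratio is common
    to all coordinates and is not 1/2, [h] is [x] or [x + d] as a whole; in the second case [x] lies
    between [q] and [h]. *)
Lemma segment_through_nonlattice x d a (q h h' : 'rV[R]_k) (rho : R) :
    grid R k x -> grid R k (x + d) ->
    (forall i, [\/ d 0 i = 0, d 0 i = 1 | d 0 i = -1]) ->
    0 <= rho < 1 -> q = x - rho *: d ->
    grid R k h -> grid R k h' -> h <> h' ->
    segment a q h -> segment a q h' ->
  segment a q x.
Proof.
move=> /gridP gx /gridP gxd dE /andP[r0 r1] qE /gridP gh /gridP gh' hh'.
have {}qE i : q 0 i = x 0 i - rho * d 0 i by rewrite qE !mxE.
have {}gxd i : [\/ x 0 i + d 0 i = 0, x 0 i + d 0 i = 1 | x 0 i + d 0 i = 2].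
  by have := gxd i; rewrite !mxE.
have qx : (forall i, q 0 i = x 0 i) -> segment a q x.
  move=> E; apply/segmentP; exists 0; first lra.
  by move=> i; rewrite E; ring.
move: r0; rewrite le_eqVlt => /orP[/eqP r0 _ _|r0].
  by apply: qx => i; rewrite qE -r0; ring.
have [[i0 di0]|d0] := pselect (exists i, d 0 i <> 0); last first.
  move=> _ _; apply: qx => i; rewrite qE (_ : d 0 i = 0); first by ring.
  by apply: contra_notP d0 => ?; exists i.
have {}di0 : d 0 i0 = 1 \/ d 0 i0 = -1 by case: (dE i0); tauto.
move=> /segmentP[al al01 hE] /segmentP[be be01 h'E].
wlog albe : h h' al be gh gh' hh' al01 be01 hE h'E / al < be.
  move=> W; case: (ltgtP al be) => [|ba|E]; first exact: (W h h').
    by apply: (W h' h) ba => // /esym.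
  by case: hh'; apply/rowP => i; rewrite hE h'E E.
have mov i (di : d 0 i = 1 \/ d 0 i = -1) :
  (h 0 i = x 0 i /\ (al * (1 + rho) = be * rho \/ al * (2 + rho) = be * rho)) \/
  (h 0 i = x 0 i + d 0 i /\ al * (2 + rho) = be * (1 + rho)).
  apply: (@moving_coordinate _ _ _ (h' 0 i) (a 0 i - q 0 i)) => //; try lra.
    by rewrite hE qE.
  by rewrite h'E qE.
have al0 : 0 < al by case: (mov _ di0) => -[_ E]; [case: E => E|]; nra.
have al2 : 2 * al <> be.
  by move=> E2; case: (mov _ di0) => -[_ E]; [case: E => E|]; nra.
have fix0 i : d 0 i = 0 -> h 0 i = x 0 i.
  move=> di; case: (@fixed_coordinate (x 0 i) (h 0 i) (h' 0 i)
    (a 0 i - q 0 i) al be) => //; first lra.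
    by rewrite hE qE di; ring.
  by rewrite h'E qE di; ring.
have [[hi0 E0]|[hi0 E0]] := mov _ di0.
  have hx : h = x.
    apply/rowP => i; have [di|di] : d 0 i = 0 \/ (d 0 i = 1 \/ d 0 i = -1).
    - by case: (dE i); tauto.
    - exact: fix0.
    - by case: (mov _ di) => -[-> E] //; exfalso; case: E0 => E0; nra.
  by rewrite -hx; apply/segmentP; exists al.
have hx i : h 0 i = x 0 i + d 0 i.
  have [di|di] : d 0 i = 0 \/ (d 0 i = 1 \/ d 0 i = -1).
  - by case: (dE i); tauto.
  - by rewrite fix0 // di addr0.
  - by case: (mov _ di) => -[-> E] //; exfalso; case: E => E; nra.
(* The point [x] divides the way from [q] to [h = x + d] in the ratio [rho : 1]. *)
apply/segmentP; exists (rho / (1 + rho) * al).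
  have : 0 <= rho / (1 + rho) <= 1.
    by rewrite divr_ge0 ?ler_pdivrMr /=; lra.
  by nra.
move=> i; have := hE i; rewrite hx => E.
have -> : rho / (1 + rho) * al * (a 0 i - q 0 i) = rho * d 0 i.
  rewrite -mulrA (_ : al * (a 0 i - q 0 i) = (1 + rho) * d 0 i).
    by field; lra.
  by move: E; rewrite qE; lra.
by rewrite qE; ring.
Qed.

(** * Corners beyond the grid *)

(* [q] lies one step beyond the grid, as seen from the grid point [c] at the
   opposite side, in each coordinate where it differs from [c]. *)
Definition corner (c q : 'rV[R]_k) : Prop :=
  forall i, [\/ q 0 i = c 0 i, q 0 i = 3 /\ c 0 i = 0 |
                q 0 i = -1 /\ c 0 i = 2].

(** Where [q <> c], the grid values are at distances 1, 2, 3 from [q], all on one side, so [al / be]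
    is 1/2, 1/3 or 2/3. Thirds force [h' = c], also where [q = c]. The ratio 1/2 leaves steps
    [h - q] of size at most 1, and three such steps lead to a corner position of [c] again. *)
Lemma corner_coordinate (c q h h' v al be : R) :
    [\/ c = 0, c = 1 | c = 2] ->
    [\/ q = c, q = 3 /\ c = 0 | q = -1 /\ c = 2] ->
    [\/ h = 0, h = 1 | h = 2] -> [\/ h' = 0, h' = 1 | h' = 2] ->
    0 <= al < be -> h = q + al * v -> h' = q + be * v ->
  [/\ q <> c -> 0 < al /\ [\/ 2 * al = be, 3 * al = be | 3 * al = 2 * be],
      0 < al -> 2 * al = be ->
        [\/ h - q = 0, h - q = 1 | h - q = -1] /\
        [\/ q + 3 * (h - q) = c, q + 3 * (h - q) = 3 /\ c = 0 |
            q + 3 * (h - q) = -1 /\ c = 2] &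
      0 < al -> 3 * al = be \/ 3 * al = 2 * be -> h' = c].
Proof.
move=> gc qc gh gh' /andP[al0 albe] hE h'E; split.
- move=> qnc; have E : be * (h - q) = al * (h' - q) by rewrite hE h'E; ring.
  clear hE h'E gc; case: qc E => [//|[-> _]|[-> _]];
  case: gh => ->; case: gh' => -> E {qnc};
  first [exfalso; lra | split; [lra|]];
  first [constructor 1; lra|constructor 2; lra|constructor 3; lra].
- move=> a0 a2; have {hE h'E} E : h' = q + 2 * (h - q).
    by rewrite hE h'E -a2; ring.
  clear al0 albe a0 a2; case: qc E gc => [->|[-> ->]|[-> ->]] E; case=> cE;
  rewrite ?cE in E *; case: gh E => ->; case: gh' => -> E;
  first [exfalso; lra|split];
  first [constructor 1; lra|constructor 2; lra|constructor 3; lra].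
- move=> a0 a3; have {hE h'E} E : h' = q + 3 * (h - q) \/ 2 * (h' - q) = 3 * (h - q).
    case: a3 => a3; [left|right]; rewrite hE h'E ?mulrA; first by rewrite -a3; ring.
    have -> : 2 * (q + be * v - q) = (2 * be) * v by ring.
    by rewrite -a3; ring.
  clear al0 albe a0 a3; case: qc E gc => [->|[-> ->]|[-> ->]] E; case=> cE;
  rewrite ?cE in E *; case: gh E => ->; case: gh' => ->; case=> E;
  lra.
Qed.

(** A ratio 1/3 or 2/3 would make the farther point equal to [c] in every coordinate, but the
    segment misses [c]. *)
Lemma corner_ratio (c q a h h' : 'rV[R]_k) (al be : R) :
    grid R k c -> corner c q -> q <> c -> ~ segment a q c ->
    grid R k h -> grid R k h' -> 0 <= al < be -> be <= 1 ->
    (forall i, h 0 i = q 0 i + al * (a 0 i - q 0 i)) ->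
    (forall i, h' 0 i = q 0 i + be * (a 0 i - q 0 i)) ->
  0 < al /\ 2 * al = be.
Proof.
move=> /gridP gc qc qnc nc /gridP gh /gridP gh' albe be1 hE h'E.
have co i := corner_coordinate (gc i) (qc i) (gh i) (gh' i) albe (hE i) (h'E i).
have [i0 qi0] : exists i, q 0 i <> c 0 i.
  by apply: contra_notP qnc => N; apply/rowP => i; apply: contra_notP N; exists i.
have [/(_ qi0)[al0 E] _ _] := co i0.
have {}E : 2 * al = be \/ (3 * al = be \/ 3 * al = 2 * be) by case: E; tauto.
split=> //; case: E => // E; case: nc.
have -> : c = h' by apply/rowP => i; case: (co i) => _ _ /(_ al0 E).
by apply/segmentP; exists be => //; lra.
Qed.

Lemma distinct_le (h h' : 'rV[R]_k) (q a : 'rV[R]_k) (al be : R) :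
    h <> h' ->
    (forall i, h 0 i = q 0 i + al * (a 0 i - q 0 i)) ->
    (forall i, h' 0 i = q 0 i + be * (a 0 i - q 0 i)) ->
  al < be \/ be < al.
Proof.
move=> hh' hE h'E; case: (ltgtP al be) => [|| E]; [by left|by right|].
by case: hh'; apply/rowP => i; rewrite hE h'E E.
Qed.

(** Let [h] be nearer to [q] and [w = h - q]. By [corner_ratio], [h' = q + 2 * w], while
    [a = q + w / al]. The side length 3 gives [3 * al >= 1]. With equality [a] is three steps from
    [q], a corner again; otherwise [a] is less than one step beyond [h'], and
    [segment_through_nonlattice] forces the next segment through [h']. *)
Lemma corner_step (c q a h h' : 'rV[R]_k) :
    grid R k c -> corner c q -> q <> c -> ~ segment a q c ->
    (forall i, -3 <= q 0 i - a 0 i <= 3) ->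
    grid R k h -> grid R k h' -> h <> h' ->
    segment a q h -> segment a q h' ->
  (corner c a /\ a <> c) \/
  forall b g g', grid R k g -> grid R k g' -> g <> g' ->
    segment b a g -> segment b a g' -> segment b a h \/ segment b a h'.
Proof.
move=> gc qc qnc nc bx gh gh' hh' /segmentP[al al01 hE] /segmentP[be be01 h'E].
wlog albe : h h' al be gh gh' hh' al01 be01 hE h'E / al < be.
  move=> W; case: (distinct_le hh' hE h'E) => [|ba]; first exact: (W h h').
  case: (W h' h be al) => //; [by move/esym|by left|move=> N; right].
  by move=> b g g' ? ? ? ? ?; rewrite or_comm; apply: (N b g g').
have albe' : 0 <= al < be by lra.
have be1 : be <= 1 by lra.
have [al0 al2] := corner_ratio gc qc qnc nc gh gh' albe' be1 hE h'E.
have gcP := (gridP c).1 gc; have ghP := (gridP h).1 gh.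
have gh'P := (gridP h').1 gh'.
have co i := corner_coordinate (gcP i) (qc i) (ghP i) (gh'P i) albe' (hE i) (h'E i).
have w1 i : [\/ h 0 i - q 0 i = 0, h 0 i - q 0 i = 1 | h 0 i - q 0 i = -1].
  by case: (co i) => _ /(_ al0 al2)[].
have [i0 wi0] : exists i, h 0 i <> q 0 i.
  apply: contra_notP hh' => N; apply/rowP => i.
  have Ei : h 0 i = q 0 i by apply: contra_notP N; exists i.
  have Z : a 0 i - q 0 i = 0.
    have /eqP := hE i; rewrite Ei addrC -subr_eq subrr eq_sym mulf_eq0.
    by move=> /orP[/eqP|/eqP//]; lra.
  by rewrite hE h'E Z !mulr0.
have al3 : 1 <= 3 * al.
  have := hE i0; have := bx i0; have := w1 i0; move: wi0.
  move: (a 0 i0) (q 0 i0) (h 0 i0) => u v r rv W /andP[ub lb] E.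
  have {W} [W|W] : r - v = 1 \/ r - v = -1.
  - by case: W => W; [case: rv; lra|left|right].
  - have : al * (u - v) = 1 by lra.
    by nra.
  - have : al * (u - v) = -1 by lra.
    by nra.
have [al3'|al3'] := eqVneq (3 * al) 1.
  left; split; last first.
    move=> ac; apply: nc; rewrite -ac; apply/segmentP; exists 1; first lra.
    by move=> i; ring.
  move=> i; have [_ /(_ al0 al2)[_] + _] := co i.
  have -> : q 0 i + 3 * (h 0 i - q 0 i) = a 0 i.
    have -> : h 0 i - q 0 i = al * (a 0 i - q 0 i) by rewrite hE; ring.
    by rewrite mulrA al3'; ring.
  by [].
right=> b g g' gg gg' gg'n sg sg'; right.
apply: (segment_through_nonlattice (x := h') (d := q - h)
  (h := g) (h' := g') (rho := al^-1 - 2)) => //.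
- rewrite (_ : h' + (q - h) = h) //; apply/rowP => i.
  by rewrite !mxE hE h'E -al2; ring.
- by move=> i; rewrite !mxE; case: (w1 i) => ?;
    [constructor 1|constructor 3|constructor 2]; lra.
- have a1 : al * al^-1 = 1 by rewrite mulfV // gt_eqF.
  have a3 : 3 * al > 1 by rewrite lt_neqAle eq_sym al3'.
  have : 0 < al^-1 by rewrite invr_gt0.
  by move: (al^-1) a1 => u; nra.
- apply/rowP => i; rewrite !mxE hE h'E -al2.
  by field; rewrite gt_eqF.
Qed.

(** * Segments with three grid points *)

(** Along a line a coordinate is constant or strictly monotone, and three strictly monotone values
    among 0, 1, 2 exhaust them in order. *)
Lemma three_coordinate (q v al be ga h0 h1 h2 : R) :
    [\/ h0 = 0, h0 = 1 | h0 = 2] -> [\/ h1 = 0, h1 = 1 | h1 = 2] ->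
    [\/ h2 = 0, h2 = 1 | h2 = 2] -> al < be < ga ->
    h0 = q + al * v -> h1 = q + be * v -> h2 = q + ga * v ->
  [/\ h1 - h0 = 0, h2 = h0 & v = 0] \/ [/\ h1 - h0 = 1, h0 = 0 & h2 = 2] \/
  [/\ h1 - h0 = -1, h0 = 2 & h2 = 0].
Proof.
move=> g0 g1 g2 /andP[ab bg] E0 E1 E2.
have [v0|[v0|v0]] : v = 0 \/ (v < 0 \/ 0 < v) by case: (ltgtP v 0); auto.
- by left; split=> //; rewrite ?E0 ?E1 ?E2 v0; ring.
- have l1 : h1 < h0 by rewrite E0 E1; nra.
  have l2 : h2 < h1 by rewrite E2 E1; nra.
  right; right; clear E0 E1 E2; case: g0 => ?; case: g1 => ?; case: g2 => ?; split; lra.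
- have l1 : h0 < h1 by rewrite E0 E1; nra.
  have l2 : h1 < h2 by rewrite E2 E1; nra.
  right; left; clear E0 E1 E2; case: g0 => ?; case: g1 => ?; case: g2 => ?; split; lra.
Qed.

(** Here [q = y0 - rho * (y1 - y0)]. A moving coordinate of [y0] is 0 or 2 and moves inwards by 1,
    so the bounds -1 and 3 give [rho <= 1]. If [rho = 1], [q] is a corner for the far point [y2]; if
    [rho < 1], [segment_through_nonlattice] applies. *)
Lemma full_line_start (q z y0 y1 y2 : 'rV[R]_k) (al be ga : R) :
    grid R k y0 -> grid R k y1 -> grid R k y2 ->
    0 <= al -> al < be < ga ->
    (forall i, y0 0 i = q 0 i + al * (z 0 i - q 0 i)) ->
    (forall i, y1 0 i = q 0 i + be * (z 0 i - q 0 i)) ->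
    (forall i, y2 0 i = q 0 i + ga * (z 0 i - q 0 i)) ->
    y0 <> y1 -> (forall i, -1 <= q 0 i <= 3) ->
  (corner y2 q /\ q <> y2) \/
  forall b g g', grid R k g -> grid R k g' -> g <> g' ->
    segment b q g -> segment b q g' -> segment b q y0.
Proof.
move=> g0 g1 g2 al0 abg E0 E1 E2 y01 bx.
have co i := three_coordinate ((gridP y0).1 g0 i) ((gridP y1).1 g1 i)
  ((gridP y2).1 g2 i) abg (E0 i) (E1 i) (E2 i).
have [i0 di0] : exists i, y0 0 i <> y1 0 i.
  by apply: contra_notP y01 => N; apply/rowP => i; apply: contra_notP N; exists i.
pose rho := al / (be - al).
have ba : 0 < be - al by lra.
have rho0 : 0 <= rho by rewrite divr_ge0 // ltW.
have qE i : q 0 i = y0 0 i - rho * (y1 0 i - y0 0 i).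
  by rewrite E1 E0 /rho; field; rewrite gt_eqF.
have rho1 : rho <= 1.
  have := bx i0; rewrite qE; case: (co i0) => [[d]|[[d e _]|[d e _]]].
  - by case: di0; lra.
  - by rewrite d e; lra.
  - by rewrite d e; lra.
have [r1|r1] := eqVneq rho 1.
  left; split.
    move=> i; rewrite qE r1; case: (co i) => [[-> -> _]|[[-> -> ->]|[-> -> ->]]].
    - by constructor 1; ring.
    - by constructor 3; split=> //; ring.
    - by constructor 2; split=> //; ring.
  move=> /rowP /(_ i0); rewrite qE r1 mul1r => e.
  case: (co i0) => [[d _ _]|[[d e0 e2]|[d e0 e2]]]; last 2 first.
  - by move: e; rewrite d e0 e2; lra.
  - by move: e; rewrite d e0 e2; lra.
  - by case: di0; lra.
right=> b g g' gg gg' gg'n sg sg'.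
apply: (segment_through_nonlattice (x := y0) (d := y1 - y0)
  (h := g) (h' := g') (rho := rho)) => //.
- by rewrite addrC subrK.
- move=> i; rewrite !mxE; case: (co i) => [[-> _ _]|[[-> _ _]|[-> _ _]]].
  + by constructor 1.
  + by constructor 2.
  + by constructor 3.
- by rewrite rho0 lt_neqAle r1 rho1.
- by apply/rowP => i; rewrite !mxE qE.
Qed.

Lemma sort_three (P : 'rV[R]_k -> Prop) (q z u v w : 'rV[R]_k) :
    P u -> P v -> P w -> u <> v -> v <> w -> w <> u ->
    segment z q u -> segment z q v -> segment z q w ->
  exists y0 y1 y2 al be ga,
    [/\ P y0, P y1 & P y2] /\ y0 <> y1 /\ [/\ 0 <= al, al < be < ga & ga <= 1] /\
    [/\ forall i, y0 0 i = q 0 i + al * (z 0 i - q 0 i),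
        forall i, y1 0 i = q 0 i + be * (z 0 i - q 0 i) &
        forall i, y2 0 i = q 0 i + ga * (z 0 i - q 0 i)].
Proof.
move=> Pu Pv Pw uv vw wu /segmentP[x x01 uE] /segmentP[y y01 vE] /segmentP[t t01 wE].
have [vu wv uw] : [/\ v <> u, w <> v & u <> w] by split; apply: nesym.
case: (distinct_le uv uE vE) => xy; case: (distinct_le vw vE wE) => yt;
  case: (distinct_le wu wE uE) => tx;
  (* Of the eight outcomes of the comparisons, the two cyclic ones are impossible. *)
  try (by exfalso; clear uv vw wu vu wv uw; lra).
- exists u, v, w, x, y, t; split=> //; split=> //; clear uv vw wu vu wv uw.
  by split=> //; split; lra.
- exists w, u, v, t, x, y; split=> //; split=> //; clear uv vw wu vu wv uw.
  by split=> //; split; lra.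
- exists u, w, v, x, t, y; split=> //; split=> //; clear uv vw wu vu wv uw.
  by split=> //; split; lra.
- exists v, w, u, y, t, x; split=> //; split=> //; clear uv vw wu vu wv uw.
  by split=> //; split; lra.
- exists v, u, w, y, x, t; split=> //; split=> //; clear uv vw wu vu wv uw.
  by split=> //; split; lra.
- exists w, v, u, t, y, x; split=> //; split=> //; clear uv vw wu vu wv uw.
  by split=> //; split; lra.
Qed.

(** * Counting newly visited grid points *)

(** Indexing the grid by a finite type gives sets of visited points a cardinality. *)
Definition grid_point (f : {ffun 'I_k -> 'I_3}) : 'rV[R]_k :=
  \row_i (f i : nat)%:R.

Lemma grid_pointE y : grid R k y <-> exists f, y = grid_point f.
Proof.
rewrite gridP; split=> [gy|[f ->] i]; last first.
  rewrite mxE; case: (f i) => -[|[|[|//]]] /= _;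
    by [constructor 1|constructor 2|constructor 3].
pose e (i : 'I_k) : 'I_3 := if y 0 i == 0 then inord 0
  else if y 0 i == 1 then inord 1 else inord 2.
exists [ffun i => e i]; apply/rowP => i; rewrite mxE ffunE /e.
by case: (gy i) => ->; rewrite ?eqxx ?oner_eq0 ?(eqr_nat R 2 0)
  ?(eqr_nat R 2 1) /= inordK.
Qed.

Lemma grid_grid_point f : grid R k (grid_point f).
Proof. by apply/grid_pointE; exists f. Qed.

Lemma grid_point_inj : injective grid_point.
Proof.
move=> f g /rowP fg; apply/ffunP => i; apply/val_inj/eqP.
by have := fg i; rewrite !mxE => /eqP; rewrite eqr_nat.
Qed.

Variables (p : nat -> 'rV[R]_k) (n : nat).

Definition visits (i : nat) : {set {ffun 'I_k -> 'I_3}} :=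
  [set f | `[< segment (p i) (p i.+1) (grid_point f) >]].

Definition visited (m : nat) : {set {ffun 'I_k -> 'I_3}} :=
  (\bigcup_(i < m) visits i)%SET.

Definition fresh (m : nat) := visits m :\: visited m.

Lemma visited0 : visited 0 = finset.set0.
Proof. by rewrite /visited big_ord0. Qed.

Lemma card_visitedS m : #|visited m.+1| = (#|visited m| + #|fresh m|)%N.
Proof.
rewrite /visited big_ord_recr /= -/(visited m) /fresh.
rewrite cardsU cardsD (finset.setIC (visits m)).
by rewrite addnBA // subset_leq_card // finset.subsetIr.
Qed.

Lemma freshP m f : f \in fresh m ->
  segment (p m) (p m.+1) (grid_point f) /\
  forall i, (i < m)%N -> ~ segment (p i) (p i.+1) (grid_point f).
Proof.
rewrite !inE => /andP[nv /asboolP sf]; split=> // i im si.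
by case/bigcupP: nv; exists (Ordinal im) => //; rewrite inE; apply/asboolP.
Qed.

Lemma fresh_pair m : (1 < #|fresh m|)%N ->
  exists f g, [/\ f \in fresh m, g \in fresh m & grid_point f <> grid_point g].
Proof.
case/card_gt1P => f [g [ff fg fgn]]; exists f, g; split=> //.
by move/grid_point_inj => E; rewrite E eqxx in fgn.
Qed.

(** The origin [q] of the parameters may be either end of the segment. *)
Lemma fresh_triple m q z : (2 < #|fresh m|)%N ->
    segment (p m) (p m.+1) = segment z q ->
  exists f0 f1 f2 al be ga,
    [/\ f0 \in fresh m, f1 \in fresh m & f2 \in fresh m] /\
    grid_point f0 <> grid_point f1 /\ [/\ 0 <= al, al < be < ga & ga <= 1] /\
    [/\ forall i, grid_point f0 0 i = q 0 i + al * (z 0 i - q 0 i),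
        forall i, grid_point f1 0 i = q 0 i + be * (z 0 i - q 0 i) &
        forall i, grid_point f2 0 i = q 0 i + ga * (z 0 i - q 0 i)].
Proof.
case/card_gt2P => f [g [h [[ff fg fh] [fgn ghn hfn]]]] sE.
have neq u v : u != v -> grid_point u <> grid_point v.
  by move=> uv /grid_point_inj E; rewrite E eqxx in uv.
have seg u : u \in fresh m -> segment z q (grid_point u).
  by move=> /freshP[]; rewrite sE.
have [y0 [y1 [y2 [al [be [ga [[P0 P1 P2] rest]]]]]]] :=
  sort_three (P := fun y => exists2 u, u \in fresh m & y = grid_point u)
    (ex_intro2 _ _ f ff erefl) (ex_intro2 _ _ g fg erefl)
    (ex_intro2 _ _ h fh erefl) (neq _ _ fgn) (neq _ _ ghn) (neq _ _ hfn)
    (seg _ ff) (seg _ fg) (seg _ fh).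
case: P0 P1 P2 rest => f0 F0 -> [f1 F1 ->] [f2 F2 ->] rest.
by exists f0, f1, f2, al, be, ga.
Qed.

(** In a coordinate where the ends differ, a point of the segment is determined by its value there,
    and the grid has three values. A degenerate segment has a single point. *)
Lemma card_visits m : (#|visits m| <= 3)%N.
Proof.
have [E|N] := pselect (p m = p m.+1).
  apply: (@leq_trans 1) => //; apply/card_le1_eqP => f g.
  rewrite !inE => /segmentP [t _ fE] /segmentP [s _ gE].
  by apply/grid_point_inj/rowP => i; rewrite fE gE E subrr !mulr0.
have [i0 Ni0] : exists i, p m 0 i <> p m.+1 0 i.
  by apply: contra_notP N => N; apply/rowP => i; apply: contra_notP N; exists i.
suff inj : {in visits m &, injective (fun f : {ffun 'I_k -> 'I_3} => f i0)}.
  by rewrite -(card_in_imset inj) (leq_trans (max_card _)) ?card_ord.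
move=> f g; rewrite !inE => /segmentP [t _ fE] /segmentP [s _ gE] fg.
have ts : t = s.
  have := fE i0; rewrite !mxE fg; have := gE i0; rewrite !mxE => -> /addrI/eqP.
  by rewrite -subr_eq0 -mulrBl mulf_eq0 !subr_eq0 => /orP[/eqP//|/eqP].
by apply/grid_point_inj/rowP => i; rewrite fE gE ts.
Qed.

(** * Lower bound: chains inside a cube of side 3 *)

Variables (lo hi : 'rV[R]_k).
Hypotheses (cube : is_hypercube 3 lo hi) (grid_box : grid R k `<=` box lo hi).
Hypothesis p_box : forall j, (j <= n)%N -> box lo hi (p j).

Lemma box_lo i : -1 <= lo 0 i <= 0.
Proof.
have g0 : grid R k (const_mx 0) by move=> j; rewrite mxE !inE eqxx.
have g2 : grid R k (const_mx 2) by move=> j; rewrite mxE !inE eqxx !orbT.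
have := grid_box g0 i; have := grid_box g2 i; have := cube i; rewrite !mxE.
lra.
Qed.

(** Otherwise, by [full_line_start], segment [m] would already visit the first of the three points
    that are new on segment [m.+1]. *)
Lemma line_start_corner m : (m.+1 <= n)%N ->
    (2 < #|fresh m.+1|)%N -> (1 < #|fresh m|)%N ->
  exists2 f, f \in fresh m.+1 &
    corner (grid_point f) (p m.+1) /\ p m.+1 <> grid_point f.
Proof.
move=> mn m3 m2.
have [f0 [f1 [f2 [al [be [ga [[F0 F1 F2] [n01 [[al0 abg ga1] [E0 E1 E2]]]]]]]]]] :=
  fresh_triple m3 (segmentC _ _).
have bx i : -1 <= p m.+1 0 i <= 3.
  by have := p_box mn i; have := box_lo i; have := cube i; lra.
have [co|co] := full_line_start (grid_grid_point f0) (grid_grid_point f1)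
  (grid_grid_point f2) al0 abg E0 E1 E2 n01 bx; first by exists f2.
have [g [g' [G G' gg']]] := fresh_pair m2.
have [_ /(_ m (ltnSn m)) []] := freshP F0.
exact: (co _ _ _ (grid_grid_point g) (grid_grid_point g') gg'
  (freshP G).1 (freshP G').1).
Qed.

(** Segment [j] misses the point of [f], which is new only later, so [corner_ratio] applies.
    Parameters [al < be < ga] would give both [be = 2 * al] and [ga = 2 * al]. *)
Lemma corner_fresh_le2 m j f : (j < m)%N -> f \in fresh m ->
    corner (grid_point f) (p j.+1) -> p j.+1 <> grid_point f ->
  (#|fresh j| <= 2)%N.
Proof.
move=> jm Ff co nf; rewrite leqNgt; apply/negP => j3.
have [f0 [f1 [f2 [al [be [ga [_ [_ [[al0 abg ga1] [E0 E1 E2]]]]]]]]]] :=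
  fresh_triple j3 erefl.
have albe : 0 <= al < be by lra.
have alga : 0 <= al < ga by lra.
have be1 : be <= 1 by lra.
have nc := (freshP Ff).2 j jm.
have [_ e1] := corner_ratio (grid_grid_point f) co nf nc
  (grid_grid_point f0) (grid_grid_point f1) albe be1 E0 E1.
have [_ e2] := corner_ratio (grid_grid_point f) co nf nc
  (grid_grid_point f0) (grid_grid_point f2) alga ga1 E0 E2.
by clear nf; lra.
Qed.

(** The other alternative of [corner_step] would let segment [j] visit a point that is new on
    segment [j.+1]. *)
Lemma corner_fresh_step m j f : (j.+1 < m)%N -> (m <= n)%N -> f \in fresh m ->
    corner (grid_point f) (p j.+2) -> p j.+2 <> grid_point f ->
    (1 < #|fresh j.+1|)%N -> (1 < #|fresh j|)%N ->
  corner (grid_point f) (p j.+1) /\ p j.+1 <> grid_point f.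
Proof.
move=> jm mn Ff co nf j2 j1.
have [g [g' [G G' gg']]] := fresh_pair j2.
have [h [h' [H H' hh']]] := fresh_pair j1.
have bx i : -3 <= p j.+2 0 i - p j.+1 0 i <= 3.
  have b1 := @p_box j.+1 ltac:(lia) i; have b2 := @p_box j.+2 ltac:(lia) i.
  by have := cube i; lra.
have [//|K] := corner_step (grid_grid_point f) co nf ((freshP Ff).2 _ jm) bx
  (grid_grid_point g) (grid_grid_point g') gg' (freshP G).1 (freshP G').1.
exfalso; have [] := K _ _ _ (grid_grid_point h) (grid_grid_point h') hh'
  (freshP H).1 (freshP H').1.
- exact: (freshP G).2.
- exact: (freshP G').2.
Qed.

(** A first violation requires equality before the last segment and three new points on it. Going
    backwards, every segment ends at a corner and so has at most 2 new points, which keeps the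
    earlier counts at their maximum. Segment 0 would then need three new points while it has at most
    two. *)
Lemma card_visited m : (m <= n)%N -> (#|visited m| <= 2 * m + 1)%N.
Proof.
elim/ltn_ind: m => -[|m] IH mn; first by rewrite visited0 cards0.
rewrite leqNgt; apply/negP => big.
have m_le := IH m (ltnSn m) ltac:(lia).
have := card_visitedS m.
have m_le3 : (#|fresh m| <= 3)%N.
  by apply: leq_trans (card_visits m); rewrite subset_leq_card // finset.subsetDl.
move=> mE; have vm : (#|visited m| = 2 * m + 1)%N by lia.
have fm : (2 < #|fresh m|)%N by lia.
case: m IH mn big m_le m_le3 mE vm fm => [|m] IH mn big m_le m_le3 mE vm fm.
  by rewrite visited0 cards0 in vm.
have vle j : (j <= m)%N -> (#|visited j| <= 2 * j + 1)%N by move=> ?; apply: IH; lia.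
have [|f Ff co0] := line_start_corner (ltnW mn) fm.
  by have := card_visitedS m; have := vle m (leqnn m); lia.
(* Descending induction on [j], carried by [e = m - j]. *)
suff K (e j : nat) : (m - j = e)%N -> (j <= m)%N ->
    [/\ (2 * j.+1 + 1 <= #|visited j.+1|)%N, corner (grid_point f) (p j.+1) &
        p j.+1 <> grid_point f].
  have [v1 c1 n1] := K m 0%N (subn0 m) (leq0n m).
  have := corner_fresh_le2 (ltn0Sn m) Ff c1 n1.
  by have := card_visitedS 0; rewrite visited0 cards0; lia.
elim: e j => [|e IHe] j jd jm.
  have -> : j = m by lia.
  by case: co0 => ? ?; split; rewrite ?vm.
have [||v1 c1 n1] := IHe j.+1; [lia|lia|].
have jm1 : (j.+1 < m.+1)%N by lia.
have jm1' : (j < m)%N by lia.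
have f2 := corner_fresh_le2 jm1 Ff c1 n1.
have := card_visitedS j.+1; have := card_visitedS j.
have := vle j (ltnW jm1'); have := vle j.+1 jm1' => h1 h0 e0 e1.
have fj : (1 < #|fresh j.+1|)%N by lia.
have fj' : (1 < #|fresh j|)%N by lia.
have [c0 n0] := corner_fresh_step jm1 (ltnW mn) Ff c1 n1 fj fj'.
by split=> //; lia.
Qed.

Lemma chain_length_ge : grid R k `<=` chain n p -> ((3 ^ k - 1) %/ 2 <= n)%N.
Proof.
move=> gc; have := card_visited (leqnn n).
suff -> : visited n = [set: {ffun 'I_k -> 'I_3}]%SET.
  by rewrite cardsT card_ffun !card_ord; lia.
apply/finset.setP => f; rewrite finset.in_setT; apply/bigcupP.
have [i /= lt_in sf] := gc _ (grid_grid_point f).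
by exists (Ordinal lt_in) => //; rewrite inE; apply/asboolP.
Qed.

End Grid.

(** * The value of the minimum *)

Lemma minimums_unique (A : set nat) (m n : nat) :
  minimums A m -> minimums A n -> m = n.
Proof.
by move=> [Am lem] [An len]; apply/eqP; rewrite eqn_leq lem // len.
Qed.

Lemma card_grid (R : realType) (k : nat) : (grid R k #= `I_(3 ^ k))%card.
Proof.
have cT : #|{: {ffun 'I_k -> 'I_3}}| = (3 ^ k)%N by rewrite card_ffun !card_ord.
pose g (i : 'I_#|{: {ffun 'I_k -> 'I_3}}|) := grid_point R (enum_val i).
rewrite -cT (_ : grid R k = g @` [set: _]); last first.
  apply/seteqP; split=> y; last by case=> i _ <-; apply: grid_grid_point.
  by case/grid_pointE => f ->; exists (enum_rank f) => //; rewrite /g enum_rankK.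
apply: (card_eq_trans (inj_card_eq _)); last by rewrite card_eq_sym card_II.
by move=> i j _ _ /grid_point_inj /enum_val_inj.
Qed.

Lemma admissible_length_ge (R : realType) (k m : nat) :
  admissible_length R k m -> ((3 ^ k - 1) %/ 2 <= m)%N.
Proof.
case=> p [gc [lo [hi [cube gb cb]]]].
apply: (chain_length_ge cube gb _ gc) => j.
(* The turning point [p m] lies on the chain as the end of segment [m.-1], which exists because some
   grid point is visited. *)
have m0 : (0 < m)%N.
  by have [i /= im _] := gc _ (grid_grid_point R [ffun=> ord0]); lia.
have [t01 s01] : (0 : R) \in `[0, 1] /\ (1 : R) \in `[0, 1].
  by rewrite !in_itv /= !lexx ler01.
rewrite leq_eqVlt => /orP[/eqP->|jm]; apply: cb.
  exists m.-1 => /=; first lia.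
  by exists 1 => //; rewrite prednK // subrr scale0r add0r scale1r.
by exists j => //; exists 0 => //; rewrite subr0 scale0r addr0 scale1r.
Qed.

Definition trail_point (R : realType) (k j : nat) : 'rV[R]_k :=
  \row_i (3 * trail k j i)%:R.

Lemma trail_point_cover (R : realType) (k : nat) : (0 < k)%N ->
  grid R k `<=` chain (trail_length k) (trail_point R k).
Proof.
move=> k0 y /grid_pointE [f ->].
pose v i := if insub i is Some i' then f i' : nat else 0%N.
have vE (i : 'I_k) : v i = f i by rewrite /v valK.
have [|j [t [jn t3 E]]] := @trail_cover k v k0.
  by move=> i ik; rewrite (vE (Ordinal ik)).
(* With vertices at [3 * 1_A] and [3 * 1_B], the parameter [t / 3] gives
   [(3 - t) * 1_A + t * 1_B]. *)
exists j => //; exists (t%:R / 3).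
  by rewrite /= in_itv /= divr_ge0 // ler_pdivrMr // mul1r ler_nat.
apply/rowP => i; rewrite !mxE -vE E // natrD !natrM natrB //.
by field.
Qed.

Lemma trail_point_box (R : realType) (k m : nat) :
  chain m (trail_point R k) `<=` box (const_mx 0) (const_mx 3).
Proof.
move=> y [j _ [t]]; rewrite /= in_itv /= => /andP[t0 t1] <- i; rewrite !mxE.
by case: (trail k j i); case: (trail k j.+1 i); rewrite ?muln0 ?muln1; nra.
Qed.

Lemma grid_sub_box (R : realType) (k : nat) :
  grid R k `<=` box (const_mx 0) (const_mx 3).
Proof. by move=> y /gridP gy i; rewrite !mxE; case: (gy i) => ->; lra. Qed.

Lemma minimum_admissible_length (R : realType) (k : nat) : (0 < k)%N ->
  minimums (admissible_length R k) ((3 ^ k - 1) %/ 2)%N.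
Proof.
move=> k0; split; last by move=> m; apply: admissible_length_ge.
exists (trail_point R k); split.
  by rewrite -trail_lengthE; apply: trail_point_cover.
exists (const_mx 0), (const_mx 3); split.
- by move=> i; rewrite !mxE subr0.
- exact: grid_sub_box.
- exact: trail_point_box.
Qed.

Lemma h_eq (R : realType) (k : nat) : (0 < k)%N ->
  h R k = ((3 ^ k - 1) %/ 2)%N.
Proof.
move=> k0; have mk := minimum_admissible_length R k k0.
exact: (minimums_unique _ _ _ (xgetI _ mk) mk).
Qed.

Theorem mainTheorem1 (R : realType) (k : nat) (hk : (1 <= k)%N) :
  [/\ minimums (admissible_length R k) (h R k),
      h R k = ((3 ^ k - 1) %/ 2)%N,
      (grid R k #= `I_(3 ^ k))%card /\
      (exists (p : nat -> 'rV[R]_k) (lo hi : 'rV[R]_k),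
         [/\ grid R k `<=` chain ((3 ^ k - 1) %/ 2)%N p,
             is_hypercube 3 lo hi,
             box_volume lo hi = 3 ^+ k,
             grid R k `<=` box lo hi &
             chain ((3 ^ k - 1) %/ 2)%N p `<=` box lo hi])
    & h R k.+1 = (3 * h R k + 1)%N /\
      (3 * h R k + 1)%N = ((3 ^ k.+1 - 1) %/ 2)%N].
Proof.
(* In terms of [trail_length] this recursion holds by definition. *)
have stepE : (3 * ((3 ^ k - 1) %/ 2) + 1)%N = ((3 ^ k.+1 - 1) %/ 2)%N.
  by rewrite -!trail_lengthE.
rewrite !h_eq // stepE; split=> //; first exact: minimum_admissible_length.
split; first exact: card_grid.
exists (trail_point R k), (const_mx 0), (const_mx 3); split.
- by rewrite -trail_lengthE; apply: trail_point_cover.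
- by move=> i; rewrite !mxE subr0.
- rewrite /box_volume (eq_bigr (fun=> 3)) => [|i _].
    by rewrite prodr_const card_ord.
  by rewrite !mxE subr0.
- exact: grid_sub_box.
- exact: trail_point_box.
Qed.
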